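(* Let $\mathcal{A}\in\mathbb{C}^{I_1\times\cdots\times I_N\times I_1\times\cdots\times I_N}$ be such that $W(\mathcal{A})=W(\mathcal{A}^H)$, and let $\alpha$ be a singular value of $\mathcal{A}$. Then $W(\mathcal{A})\cap\alpha^2W(\mathcal{A}^\dagger)\neq\emptyset$.
   Context: For tensors $\mathcal{A},\mathcal{B}\in\mathbb{C}^{I_1\times\cdots\times I_N\times I_1\times\cdots\times I_N}$ the Einstein product is $(\mathcal{A}*_N\mathcal{B})_{i_1\ldots i_Nj_1\ldots j_N}=\sum_{k_1,\ldots,k_N}a_{i_1\ldots i_Nk_1\ldots k_N}b_{k_1\ldots k_Nj_1\ldots j_N}$, and for $\mathcal{X}\in\mathbb{C}^{I_1\times\cdots\times I_N}$, $(\mathcal{A}*_N\mathcal{X})_{i_1\ldots i_N}=\sum_{k_1,\ldots,k_N}a_{i_1\ldots i_Nk_1\ldots k_N}x_{k_1\ldots k_N}$. The conjugate transpose is $(\mathcal{A}^H)_{i_1\ldots i_Nj_1\ldots j_N}=\overline{a_{j_1\ldots j_Ni_1\ldots i_N}}$. A number $\lambda\in\mathbb{C}$ is an eigenvalue of $\mathcal{A}$ if $\mathcal{A}*_N\mathcal{X}=\lambda\mathcal{X}$ for some nonzero $\mathcal{X}\in\mathbb{C}^{I_1\times\cdots\times I_N}$. The singular values of $\mathcal{A}$ are the nonnegative square roots of the eigenvalues of $\mathcal{A}^H*_N\mathcal{A}$. The Moore--Penrose inverse $\mathcal{A}^\dagger$ of $\mathcal{A}$ is the unique tensor $\mathcal{X}$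 of the same size satisfying $\mathcal{A}*_N\mathcal{X}*_N\mathcal{A}=\mathcal{A}$, $\mathcal{X}*_N\mathcal{A}*_N\mathcal{X}=\mathcal{X}$, $(\mathcal{A}*_N\mathcal{X})^H=\mathcal{A}*_N\mathcal{X}$, $(\mathcal{X}*_N\mathcal{A})^H=\mathcal{X}*_N\mathcal{A}$. With $\langle\mathcal{X},\mathcal{Y}\rangle=\sum_{i_1,\ldots,i_N}x_{i_1\ldots i_N}\overline{y_{i_1\ldots i_N}}$ and $\|\mathcal{X}\|=\langle\mathcal{X},\mathcal{X}\rangle^{1/2}$, the numerical range is $W(\mathcal{A})=\{\langle\mathcal{A}*_N\mathcal{X},\mathcal{X}\rangle:\mathcal{X}\in\mathbb{C}^{I_1\times\cdots\times I_N},\|\mathcal{X}\|=1\}$, and $\alpha^2W(\mathcal{A}^\dagger)=\{\alpha^2z:z\in W(\mathcal{A}^\dagger)\}$. *)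

(* Defs.v *)
From HB Require Import structures.
From mathcomp Require Import all_boot all_order all_algebra complex.
From mathcomp Require Import boolp classical_sets reals.

Set Implicit Arguments.
Unset Strict Implicit.
Unset Printing Implicit Defensive.

Import Order.TTheory GRing.Theory Num.Theory.

Local Open Scope classical_set_scope.
Local Open Scope ring_scope.
Local Open Scope complex_scope.

(* Multi-indices (i_1, ..., i_N) with 0 <= i_k < I k (0-based). *)
Definition midx (N : nat) (I : 'I_N -> nat) : finType :=
  {dffun forall k : 'I_N, 'I_(I k)}.

(* C^{I_1 x ... x I_N} *)
Definition tensor (R : realType) (N : nat) (I : 'I_N -> nat) :=
  {ffun midx I -> R[i]}.

(* C^{I_1 x ... x I_N x I_1 x ... x I_N}: an order-2N index is the pair formed
   by its first N and its last N components. *)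
Definition sqtensor (R : realType) (N : nat) (I : 'I_N -> nat) :=
  {ffun midx I * midx I -> R[i]}.

Section Tensors.
Context {R : realType} {N : nat} {I : 'I_N -> nat}.
Implicit Types (A B X : sqtensor R I) (x y : tensor R I).

Definition einstein A B : sqtensor R I :=
  [ffun ij => \sum_(k : midx I) A (ij.1, k) * B (k, ij.2)].

Definition einstein_app A x : tensor R I :=
  [ffun i => \sum_(k : midx I) A (i, k) * x k].

Definition conjtr A : sqtensor R I := [ffun ij => Num.conj (A (ij.2, ij.1))].

(* The scalar action is written pointwise because the library's [*:%R] on
   R[i]-valued functions is that of the real scalars R. *)
Definition is_eigenvalue A (lambda : R[i]) : Prop :=
  exists2 x : tensor R I,
    x != 0 & einstein_app A x = [ffun i => lambda * x i].

Definition is_singular_value A (alpha : R) : Prop :=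
  0 <= alpha /\
  exists2 lambda : R[i],
    is_eigenvalue (einstein (conjtr A) A) lambda & (alpha%:C) ^+ 2 = lambda.

Definition is_mp_inverse A X : Prop :=
  [/\ einstein (einstein A X) A = A,
      einstein (einstein X A) X = X,
      conjtr (einstein A X) = einstein A X
    & conjtr (einstein X A) = einstein X A].

(* Definite description; the default 0 is never used, since a Moore-Penrose
   inverse always exists (and is unique). *)
Definition mp_inverse A : sqtensor R I :=
  xget 0 [set X | is_mp_inverse A X].

Definition inner x y : R[i] := \sum_(i : midx I) x i * Num.conj (y i).

Definition tnorm x : R[i] := sqrtC (inner x x).

Definition numerical_range A : set R[i] :=
  [set inner (einstein_app A x) x | x in [set x : tensor R I | tnorm x = 1]].

End Tensors.

(* Main.v *)
(** Let [A^H A x = alpha^2 x] with [x != 0], put [y = A x] and let [X] be the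
    Moore-Penrose inverse of [A].  Since [X A A^H = (A X A)^H = A^H], applying
    [X A] to [A^H y = alpha^2 x] gives [A^H y = alpha^2 X y].  If [y != 0],
    the Rayleigh quotient at [y] thus yields a point common to [W(A^H) = W(A)]
    and [alpha^2 W(X)].  If [y = 0], then [alpha = 0] and [0] belongs to [W(A)].

    The existence of [X] comes from a full-rank factorization [A = K B], as
    [X = B^H (B B^H)^-1 (K^H K)^-1 K^H]. *)

Require Import Defs.
From mathcomp Require Import all_boot all_order all_algebra complex.
From mathcomp Require Import boolp classical_sets reals.

Set Implicit Arguments.
Unset Strict Implicit.
Unset Printing Implicit Defensive.

Import Order.TTheory GRing.Theory Num.Theory.

Local Open Scope classical_set_scope.
Local Open Scope ring_scope.
Local Open Scope complex_scope.

Section MatrixMoorePenrose.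
Variable C : numClosedFieldType.

Local Notation "M '^H'" := (map_mx Num.conj M^T) (at level 2, format "M '^H'").

Lemma adjmxM m n p (M : 'M[C]_(m, n)) (M' : 'M[C]_(n, p)) :
  (M *m M')^H = M'^H *m M^H.
Proof. by rewrite trmx_mul map_mxM. Qed.

Lemma adjmxK m n (M : 'M[C]_(m, n)) : M^H^H = M.
Proof. by apply/matrixP=> i j; rewrite !mxE conjCK. Qed.

Lemma mulmx_adj_eq0 n (v : 'rV[C]_n) : v *m v^H = 0 -> v = 0.
Proof.
move=> /matrixP /(_ 0 0); rewrite !mxE => v0.
apply/rowP=> j; rewrite mxE; apply/eqP; rewrite -mul_conjC_eq0.
have /psumr_eq0P : \sum_i v 0 i * Num.conj (v 0 i) = 0.
  by rewrite -[RHS]v0; apply: eq_bigr => i _; rewrite !mxE.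
by move=> ->// i _; apply: mul_conjC_ge0.
Qed.

(** If [v] lies in the left kernel of [B *m B^H], then [v B] has squared norm [v B B^H v^H = 0], so
    [v B = 0], and freeness of the rows forces [v = 0]. *)
Lemma gram_unitmx m n (B : 'M[C]_(m, n)) : row_free B -> B *m B^H \in unitmx.
Proof.
move=> Bfree; rewrite -row_free_unit -kermx_eq0; apply/eqP/row_matrixP=> i.
rewrite row0; set v := row i _.
have vBB : v *m (B *m B^H) = 0 by rewrite -row_mul mulmx_ker row0.
have /mulmx_adj_eq0 vB : (v *m B) *m (v *m B)^H = 0.
  by rewrite adjmxM mulmxA -(mulmxA v) vBB mul0mx.
by apply: (row_free_inj Bfree); rewrite vB mul0mx.
Qed.

Lemma matrix_mp_inverse n (M : 'M[C]_n) : exists X : 'M[C]_n,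
  [/\ M *m X *m M = M, X *m M *m X = X,
      (M *m X)^H = M *m X & (X *m M)^H = X *m M].
Proof.
have [r [K [B [-> GB GK]]]] : exists r (K : 'M_(n, r)) (B : 'M_(r, n)),
    [/\ M = K *m B, B *m B^H \in unitmx & K^H *m K \in unitmx].
  exists (\rank M), (col_base M), (row_base M); split.
  - by rewrite mulmx_base.
  - by rewrite gram_unitmx ?row_base_free.
  (* [K] has full column rank, so [K^H] has free rows; its Gram matrix is
     [K^H *m K^H^H = K^H *m K]. *)
  - rewrite -{2}(adjmxK (col_base M)) gram_unitmx // /row_free.
    by rewrite mxrank_map mxrank_tr; exact: col_base_full.
set G := B *m B^H in GB; set L := K^H *m K in GK.
have GH : (invmx G)^H = invmx G.
  by rewrite trmx_inv map_invmx; congr invmx; rewrite adjmxM adjmxK.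
have LH : (invmx L)^H = invmx L.
  by rewrite trmx_inv map_invmx; congr invmx; rewrite adjmxM adjmxK.
pose X := B^H *m invmx G *m (invmx L *m K^H).
(* [M X] and [X M] reduce to the orthogonal projections onto the column space of [K] and the row
   space of [B], which makes both Hermitian. *)
have MX : K *m B *m X = K *m invmx L *m K^H.
  rewrite /X -!mulmxA; congr (_ *m _).
  by rewrite !mulmxA mulmxV // mul1mx.
have XM : X *m (K *m B) = B^H *m invmx G *m B.
  rewrite /X -!mulmxA; do 2 congr (_ *m _).
  by rewrite (mulmxA K^H) (mulmxA (invmx L)) mulVmx // mul1mx.
exists X; split.
- rewrite MX -!mulmxA; congr (_ *m _).
  by rewrite (mulmxA K^H) mulmxA mulVmx // mul1mx.
- rewrite XM /X -!mulmxA; congr (_ *m _); congr (_ *m _).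
  by rewrite !mulmxA -/G mulmxV // mul1mx.
- by rewrite MX !adjmxM adjmxK LH mulmxA.
- by rewrite XM !adjmxM adjmxK GH mulmxA.
Qed.

End MatrixMoorePenrose.

Section TensorAlgebra.
Context {R : realType} {N : nat} {I : 'I_N -> nat}.
Implicit Types (A B D : sqtensor R I) (x y : tensor R I).

Lemma einsteinA A B D :
  einstein A (einstein B D) = einstein (einstein A B) D.
Proof.
apply/ffunP=> -[i j]; rewrite !ffunE /=.
under eq_bigr do rewrite ffunE mulr_sumr.
rewrite exchange_big; apply: eq_bigr => k _.
by rewrite ffunE mulr_suml; apply: eq_bigr => l _; rewrite mulrA.
Qed.

Lemma conjtr_einstein A B :
  conjtr (einstein A B) = einstein (conjtr B) (conjtr A).
Proof.
apply/ffunP=> ij; rewrite !ffunE rmorph_sum.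
by apply: eq_bigr => k _; rewrite !ffunE rmorphM mulrC.
Qed.

Lemma einstein_app_comp A B x :
  einstein_app (einstein A B) x = einstein_app A (einstein_app B x).
Proof.
apply/ffunP=> i; rewrite !ffunE.
under eq_bigr do rewrite !ffunE mulr_suml.
rewrite exchange_big; apply: eq_bigr => k _.
by rewrite ffunE mulr_sumr; apply: eq_bigr => l _; rewrite mulrA.
Qed.

Lemma einstein_appZ A (c : R[i]) x :
  einstein_app A [ffun i => c * x i] = [ffun i => c * einstein_app A x i].
Proof.
apply/ffunP=> i; rewrite !ffunE mulr_sumr.
by apply: eq_bigr => k _; rewrite !ffunE mulrCA.
Qed.

Lemma inner_scalel (c : R[i]) x y : inner [ffun i => c * x i] y = c * inner x y.
Proof. by rewrite /inner mulr_sumr; apply: eq_bigr => i _; rewrite ffunE mulrA. Qed.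

Lemma inner_scaler (c : R[i]) x y :
  inner x [ffun i => c * y i] = Num.conj c * inner x y.
Proof.
rewrite /inner mulr_sumr; apply: eq_bigr => i _.
by rewrite ffunE rmorphM mulrCA.
Qed.

Lemma inner_ge0 x : 0 <= inner x x.
Proof. by apply: sumr_ge0 => i _; apply: mul_conjC_ge0. Qed.

Lemma inner_eq0 x : inner x x = 0 -> x = 0.
Proof.
move=> /psumr_eq0P x0; apply/ffunP=> i; rewrite ffunE.
apply/eqP; rewrite -mul_conjC_eq0; apply/eqP/x0 => // j _.
exact: mul_conjC_ge0.
Qed.

(** Normalize [x] by [c = 1 / tnorm x]: since [c] is real, the two slots of the inner product
    contribute [c * c = 1 / inner x x]. *)
Lemma rayleigh_numerical_range A x : x != 0 ->
  numerical_range A (inner (einstein_app A x) x / inner x x).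
Proof.
move=> x0; have xx0 : inner x x != 0 by apply: contra_neq x0; exact: inner_eq0.
pose c := (tnorm x)^-1.
have c_real : Num.conj c = c.
  by apply/conj_Creal/ger0_real; rewrite invr_ge0 sqrtC_ge0 inner_ge0.
have cc : c * c = (inner x x)^-1 by rewrite -invfM -expr2 sqrtCK.
exists [ffun i => c * x i].
  by rewrite /= /tnorm inner_scalel inner_scaler c_real mulrA cc mulVf // sqrtC1.
by rewrite einstein_appZ inner_scalel inner_scaler c_real mulrA cc mulrC.
Qed.

(** Enumerating the multi-indices flattens a tensor to a square matrix, so that the matrix
    Moore-Penrose inverse can be carried back to tensors. *)
Definition mx_of_tensor A : 'M[R[i]]_#|midx I| :=
  \matrix_(i, j) A (enum_val i, enum_val j).

Definition tensor_of_mx (M : 'M[R[i]]_#|midx I|) : sqtensor R I :=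
  [ffun ij => M (enum_rank ij.1) (enum_rank ij.2)].

Lemma mx_of_tensorK : cancel mx_of_tensor tensor_of_mx.
Proof. by move=> A; apply/ffunP=> -[i j]; rewrite ffunE mxE !enum_rankK. Qed.

Lemma tensor_of_mxM M M' :
  tensor_of_mx (M *m M') = einstein (tensor_of_mx M) (tensor_of_mx M').
Proof.
apply/ffunP=> ij; rewrite !ffunE mxE (reindex enum_rank) /=; last first.
  exact/onW_bij/enum_rank_bij.
by apply: eq_bigr => k _; rewrite !ffunE.
Qed.

Lemma tensor_of_mx_adj M :
  tensor_of_mx (map_mx Num.conj M^T) = conjtr (tensor_of_mx M).
Proof. by apply/ffunP=> ij; rewrite !ffunE !mxE. Qed.

(** Existence suffices for [xget] to return a solution rather than its default. The four equations
    are transported from matrices, as [tensor_of_mx] respects products and adjoints. *)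
Lemma mp_inverseP A : is_mp_inverse A (mp_inverse A).
Proof.
suff: [set X | is_mp_inverse A X] (mp_inverse A) by [].
have [X [MXM XMX MX XM]] := matrix_mp_inverse (mx_of_tensor A).
apply: (xgetPex 0); exists (tensor_of_mx X).
split; rewrite -{1}(mx_of_tensorK A).
- by rewrite -{2}(mx_of_tensorK A) -!tensor_of_mxM MXM mx_of_tensorK.
- by rewrite -!tensor_of_mxM XMX.
- by rewrite -{2}(mx_of_tensorK A) -!tensor_of_mxM -tensor_of_mx_adj MX.
- by rewrite -{2}(mx_of_tensorK A) -!tensor_of_mxM -tensor_of_mx_adj XM.
Qed.

(** As [X A] is Hermitian, it may be replaced by its adjoint, which merges with [A^H] into
    [(A X A)^H]. *)
Lemma mp_inverse_conjtr A :
  einstein (einstein (mp_inverse A) A) (conjtr A) = conjtr A.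
Proof.
have [AXA _ _ XA] := mp_inverseP A.
by rewrite -XA -conjtr_einstein einsteinA AXA.
Qed.

End TensorAlgebra.

Theorem theorem5p5 (R : realType) (N : nat) (I : 'I_N -> nat)
    (A : sqtensor R I) (alpha : R)
    (hW : numerical_range A = numerical_range (conjtr A))
    (halpha : is_singular_value A alpha) :
  numerical_range A `&`
    [set (alpha%:C) ^+ 2 * z | z in numerical_range (mp_inverse A)] !=set0.
Proof.
case: halpha => _ [lambda [x x0 +] alphaE]; rewrite -{}alphaE.
rewrite einstein_app_comp; set a := _ ^+ 2; set y := einstein_app A x => AHy.
have [y0|y0] := eqVneq y 0.
  (* Here [a x = A^H 0 = 0] with [x] nonzero. *)
  have a0 : a = 0.
    apply: contra_neq_eq x0 => a_neq0; apply/ffunP=> i.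
    have /ffunP/(_ i) := AHy; rewrite y0 !ffunE big1 => [|k _]; last first.
      by rewrite !ffunE mulr0.
    by move/esym/eqP; rewrite mulf_eq0 (negPf a_neq0) => /eqP.
  have inner0 : inner y x = 0.
    by rewrite y0 /inner big1 // => i _; rewrite ffunE mul0r.
  (* The Rayleigh quotient of [A] at [x] is 0, and multiplying any point of the other range by
     [a = 0] gives 0 too; the quotient at [x] serves as that point. *)
  exists 0; split.
    by have := rayleigh_numerical_range A x0; rewrite -/y inner0 mul0r.
  exists (inner (einstein_app (mp_inverse A) x) x / inner x x).
    exact: rayleigh_numerical_range.
  by rewrite a0 mul0r.
(* Write [A^H y] as [X A (A^H y) = X A (a x) = a X y]. *)
have AHyE : einstein_app (conjtr A) y =
    [ffun i => a * einstein_app (mp_inverse A) y i].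
  by rewrite -{1}mp_inverse_conjtr !einstein_app_comp AHy !einstein_appZ.
(* This quotient lies in the range of [A^H]; [hW] moves it to that of [A]. *)
exists (inner (einstein_app (conjtr A) y) y / inner y y); split.
  by rewrite hW; exact: rayleigh_numerical_range.
exists (inner (einstein_app (mp_inverse A) y) y / inner y y).
  exact: rayleigh_numerical_range.
by rewrite AHyE inner_scalel mulrA.
Qed.
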